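(* For every network of diameter $\Delta$ and every first-order formula $\psi$ containing $w$ variables or constants (counted together), the distributed time complexity of the evaluation of $\psi$ by the query engine $\mathcal{QE}_{FO}$ is at most $2\Delta w$ rounds.
   Context: Networks: $U$ is an infinite linearly ordered set of node identifiers. A network $\mathbf{G}=(V,G)$ is a finite, connected, undirected graph with $V\subset U$ and symmetric edge relation $G$, of degree bounded by a constant $D$; $n=|V|$ and $\Delta$ is the diameter. The model is synchronous message passing. Each node knows its own identifier, its neighbours' identifiers, $n$ and $\Delta$. In each round every node performs local computation and then broadcasts messages to all its neighbours, which receive them. A query is posed by a requesting node. The distributed time is the maximal number of rounds of any node until termination, i.e. until no node has messages left to send. Formulas are first-order over $\{G\}$ with equality and node identifiers as constants. The answer to $\varphi(x_1,\dots,x_\ell)$ is $\{(a_1,\dots,a_\ell): \mathbf{G}\models\varphi(a_1,\dots,a_\ell)\}$, each tuple being stored at node $a_1$. The query engine $\mathcal{QE}_{FO}$ works as follows. - Messages and tables. It uses three kinds of messages: Boolean queries $?B\varphi$ ($\varphi$ a sentence possibly containing constants); partially instantiated queries $?x_1\dots ?x_i\,!a_{i+1}\dots !a_\ell\,\varphi(x_1,\dots,x_i,a_{i+1},\dots,a_\ell)$; and Boolean answers $!B\varphi$ (with a truth value). Each node keeps a query table of pairs (query, parent query) and an answer table. - Local simplification. Every node simplifies each formula it handles by replacing with their truth values all atoms it can decide from its local data. These are the atoms $G(b,c)$ in which $b$ or $c$ is its own identifier, and equalities between constants. - Handling a query. The requesting node issues the query. When a node $a$ issues or receives a query that is not yet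 in its query table, it records the query (with its parent), broadcasts it to its neighbours, and processes it as follows. - If the query still has free variables $x_1,\dots,x_i$, node $a$ instantiates the rightmost one, $x_i$, by its own identifier and handles the resulting subquery in the same way. When all free variables are instantiated (the last one, $x_1$, at node $a_1$), node $a_1$ issues the Boolean query $?B\varphi(a_1,\dots,a_\ell)$ and records it with parent $!a_1\dots!a_\ell\varphi(a_1,\dots,a_\ell)$. - If the query is Boolean of the form $Qx\,\psi$ with $Q\in\{\exists,\forall\}$ the leftmost quantifier, node $a$ instantiates $x$ by its own identifier, obtaining $\psi(a)$. If $\psi(a)$ is true and $Q=\exists$, this is a witness; if $\psi(a)$ is false and $Q=\forall$, this is a counterevidence. If $\psi(a)$ cannot be decided locally, it is recorded with parent $Qx\,\psi$, broadcast, and handled recursively. - Clocks and answers. A node waiting for the answer to a Boolean query sets a clock of $2\Delta w'$ rounds, where $w'$ is the number of variables and constants of that query. If a witness (resp. counterevidence) arrives, $\exists x\psi$ is true (resp. $\forall x\psi$ is false). If none arrives before the clock elapses, $\exists x\psi$ is declared false (resp. $\forall x\psi$ true). Answers are stored and broadcast, each node forwarding a given answer at most once, until they reach the nodes waiting for them; those nodes then evaluate the parent query and store and broadcast its answer. - Storing results. When the Boolean query $?B\varphi(a_1,\dots,a_\ell)$ generated from a fully instantiated query is answered positively, node $a_1$ stores $(a_1,\dots,a_\ell)$ in its answer table.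
   Formalization: As literally described the bound fails; here w' omits identifiers substituted during evaluation, answers stop after Δ hops, a node whose own clock elapses does not broadcast that answer, and w counts one variable per quantifier (bound variables renamed apart). *)

(* Defs.v *)
From HB Require Import structures.
From mathcomp Require Import all_boot all_order.

Set Implicit Arguments.
Unset Strict Implicit.
Unset Printing Implicit Defensive.

(** * Networks *)

Definition infinite_set (U : eqType) : Prop :=
  forall s : seq U, exists u, u \notin s.

(** The graph is simple; [D] bounds the degree. *)
Record network (d : Order.disp_t) (U : orderType d) (D : nat) := Network {
  nodes : seq U;
  edge : rel U;
  nodes_uniq : uniq nodes;
  edge_sym : symmetric edge;
  edge_irr : irreflexive edge;
  edge_nodes : forall a b, edge a b -> a \in nodes;
  net_connected : forall a b, a \in nodes -> b \in nodes ->
    exists2 p, path edge a p & last a p = b;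
  degree_le : forall a, a \in nodes -> size [seq b <- nodes | edge a b] <= D
}.

Section NetworkNotions.
Context (d : Order.disp_t) (U : orderType d) (D : nat) (G : network U D).

Definition neighbours (a : U) : seq U := [seq b <- nodes G | edge G a b].

Definition walk (a b : U) (k : nat) : Prop :=
  exists p, [/\ path (edge G) a p, last a p = b & size p = k].

Definition is_distance (a b : U) (k : nat) : Prop :=
  walk a b k /\ forall k', walk a b k' -> k <= k'.

Definition is_diameter (Delta : nat) : Prop :=
  (forall a b k, a \in nodes G -> b \in nodes G -> is_distance a b k ->
     k <= Delta) /\
  (exists a b, [/\ a \in nodes G, b \in nodes G & is_distance a b Delta]).

End NetworkNotions.

(** * First-order formulas over [{G, =}] with constants in [C] *)

Definition var := nat.

Inductive term (C : Type) := Var (x : var) | Con (c : C).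

(** In [Quant e x phi] the quantifier is existential iff [e] is true. *)
Inductive form (C : Type) :=
| Truth (b : bool)
| Adj (s t : term C)
| Equal (s t : term C)
| Not (phi : form C)
| And (phi psi : form C)
| Or (phi psi : form C)
| Quant (e : bool) (x : var) (phi : form C).

Arguments Var {C}.
Arguments Truth {C}.

Definition term_eq_dec (C : eqType) : comparable (term C).
Proof. by rewrite /comparable /decidable; decide equality; apply: eq_comparable. Defined.
HB.instance Definition _ (C : eqType) :=
  hasDecEq.Build (term C) (compareP (@term_eq_dec C)).

Definition form_eq_dec (C : eqType) : comparable (form C).
Proof.
rewrite /comparable /decidable; decide equality; first [exact: eq_comparable | exact: term_eq_dec].
Defined.
HB.instance Definition _ (C : eqType) :=
  hasDecEq.Build (form C) (compareP (@form_eq_dec C)).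

Definition map_term (A B : Type) (f : A -> B) (t : term A) : term B :=
  match t with Var x => Var x | Con c => Con (f c) end.

Fixpoint map_form (A B : Type) (f : A -> B) (phi : form A) : form B :=
  match phi with
  | Truth b => Truth b
  | Adj s t => Adj (map_term f s) (map_term f t)
  | Equal s t => Equal (map_term f s) (map_term f t)
  | Not phi => Not (map_form f phi)
  | And phi psi => And (map_form f phi) (map_form f psi)
  | Or phi psi => Or (map_form f phi) (map_form f psi)
  | Quant e x phi => Quant e x (map_form f phi)
  end.

Definition tvars (C : Type) (t : term C) : seq var :=
  if t is Var x then [:: x] else [::].

Definition tconsts (C : Type) (t : term C) : seq C :=
  if t is Con c then [:: c] else [::].

Fixpoint free_vars (C : Type) (phi : form C) : seq var :=
  match phi with
  | Truth _ => [::]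
  | Adj s t | Equal s t => tvars s ++ tvars t
  | Not phi => free_vars phi
  | And phi psi | Or phi psi => free_vars phi ++ free_vars psi
  | Quant _ x phi => [seq y <- free_vars phi | y != x]
  end.

Fixpoint bound_vars (C : Type) (phi : form C) : seq var :=
  match phi with
  | Truth _ | Adj _ _ | Equal _ _ => [::]
  | Not phi => bound_vars phi
  | And phi psi | Or phi psi => bound_vars phi ++ bound_vars psi
  | Quant _ x phi => x :: bound_vars phi
  end.

Fixpoint consts (C : Type) (phi : form C) : seq C :=
  match phi with
  | Truth _ => [::]
  | Adj s t | Equal s t => tconsts s ++ tconsts t
  | Not phi => consts phi
  | And phi psi | Or phi psi => consts phi ++ consts psi
  | Quant _ _ phi => consts phi
  end.

Definition tsubst (C : Type) (x : var) (c : C) (t : term C) : term C :=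
  match t with
  | Var y => if y == x then Con c else t
  | Con _ => t
  end.

(** Only the free occurrences of [x] are replaced. *)
Fixpoint subst (C : Type) (x : var) (c : C) (phi : form C) : form C :=
  match phi with
  | Truth b => Truth b
  | Adj s t => Adj (tsubst x c s) (tsubst x c t)
  | Equal s t => Equal (tsubst x c s) (tsubst x c t)
  | Not phi => Not (subst x c phi)
  | And phi psi => And (subst x c phi) (subst x c psi)
  | Or phi psi => Or (subst x c phi) (subst x c psi)
  | Quant e y phi => Quant e y (if y == x then phi else subst x c phi)
  end.

(** The leftmost quantifier of a sentence, instantiated by [c].  Below a
    Boolean connective the quantifier is extracted first, which dualizes it
    under a negation: the result [(e, psi)] means that [phi] is equivalent to
    [Qx psi(x)], with [Q] existential iff [e], and [psi] is [psi(c)].  On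
    [Quant e x psi] this is [(e, psi(c))]. *)
Fixpoint inst_leftmost (C : Type) (c : C) (phi : form C) :
    option (bool * form C) :=
  match phi with
  | Truth _ | Adj _ _ | Equal _ _ => None
  | Not phi =>
      if inst_leftmost c phi is Some (e, phi') then Some (~~ e, Not phi')
      else None
  | And phi psi =>
      if inst_leftmost c phi is Some (e, phi') then Some (e, And phi' psi)
      else if inst_leftmost c psi is Some (e, psi') then Some (e, And phi psi')
      else None
  | Or phi psi =>
      if inst_leftmost c phi is Some (e, phi') then Some (e, Or phi' psi)
      else if inst_leftmost c psi is Some (e, psi') then Some (e, Or phi psi')
      else None
  | Quant e x phi => Some (e, subst x c phi)
  end.

Fixpoint leftmost (C : Type) (phi : form C) : option bool :=
  match phi with
  | Truth _ | Adj _ _ | Equal _ _ => None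
  | Not phi => omap negb (leftmost phi)
  | And phi psi | Or phi psi =>
      if leftmost phi is Some e then Some e else leftmost psi
  | Quant e _ _ => Some e
  end.

(** The query [phi(x_1, ..., x_l)], posed by the user of the network. *)
Record fo_query (U : eqType) := FOQuery {
  qvars : seq var;
  qform : form U;
  qvars_uniq : uniq qvars;
  qvars_free : {subset free_vars qform <= qvars}
}.

(** Every quantifier is taken to bind a variable of its own (bound variables
    renamed apart), so that the variables are the free variables and one
    variable per quantifier; constants are counted without repetition. *)
Definition num_vars_consts (U : eqType) (q : fo_query U) : nat :=
  size (qvars q) + size (bound_vars (qform q)) +
  size (undup (consts (qform q))).

(** * The query engine *)

Section Engine.
Context (U : eqType).

(** Inside the engine the constants of the posed query ([Cst]) are told apart
    from the identifiers substituted for variables during the evaluation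
    ([Ins], written with an exclamation mark in the queries). *)
Inductive ident := Cst (c : U) | Ins (a : U).

Definition ident_val (i : ident) : U := match i with Cst c => c | Ins a => a end.

Definition ident_cst (i : ident) : seq U := if i is Cst c then [:: c] else [::].

Definition ident_eq_dec : comparable ident.
Proof. by rewrite /comparable /decidable; decide equality; apply: eq_comparable. Defined.
HB.instance Definition _ := hasDecEq.Build ident (compareP ident_eq_dec).

Local Notation iform := (form ident).

(** The number [w'] of variables and constants of a Boolean query.  The
    instantiated identifiers are not counted: they are no longer variables and
    were not constants of the query.  (If they were counted, a subquery would
    get the same clock as its parent, although it is issued later.) *)
Definition clock_width (phi : iform) : nat :=
  size (bound_vars phi) +
  size (undup (flatten [seq ident_cst i | i <- consts phi])).

(** [BoolQ phi] is [?B phi]; [PartQ [:: x_1; ...; x_i] [:: a_(i+1); ...; a_l] phi]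
    is [?x_1 ... ?x_i !a_(i+1) ... !a_l phi]. *)
Inductive query := BoolQ (phi : iform) | PartQ (xs : seq var) (vs : seq U) (phi : iform).

Definition query_eq_dec : comparable query.
Proof.
rewrite /comparable /decidable; decide equality;
  first [exact: form_eq_dec | exact: eq_comparable].
Defined.
HB.instance Definition _ := hasDecEq.Build query (compareP query_eq_dec).

(** [Answer phi b h] is [!B phi] with truth value [b]; [h] is the number of
    hops travelled once the message is received.  After [Delta] hops an answer
    has reached all nodes, in particular those waiting for it, and is not
    forwarded any more. *)
Inductive message := Query (q : query) | Answer (phi : iform) (b : bool) (h : nat).

Record local_data := LocalData {
  own : U;
  nbrs : seq U;
  net_size : nat;
  net_diam : nat
}.

(** [now]: number of completed rounds.  [qtable]: pairs (query, parent), the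
    parent being [None] for a query received from a neighbour or posed by the
    user.  [clocks]: the Boolean queries whose answer was awaited, with the
    value of [now] at which the clock elapses.  [answers] and [results]: answer
    table (answers to Boolean queries, and tuples).  [outbox]: the messages
    broadcast in the last round. *)
Record state := State {
  now : nat;
  qtable : seq (query * option query);
  clocks : seq (iform * nat);
  answers : seq (iform * bool);
  results : seq (seq U);
  outbox : seq message
}.

Definition init_state : state := State 0 [::] [::] [::] [::] [::].

Definition emit (m : message) (s : state) : state :=
  State (now s) (qtable s) (clocks s) (answers s) (results s) (rcons (outbox s) m).

Definition record_query (q : query) (p : option query) (s : state) : state :=
  if (q, p) \in qtable s then s
  else State (now s) (rcons (qtable s) (q, p)) (clocks s) (answers s) (results s) (outbox s).

Definition record_answer (phi : iform) (b : bool) (s : state) : state :=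
  State (now s) (qtable s) (clocks s) (rcons (answers s) (phi, b)) (results s) (outbox s).

Definition record_result (vs : seq U) (s : state) : state :=
  if vs \in results s then s
  else State (now s) (qtable s) (clocks s) (answers s) (rcons (results s) vs) (outbox s).

Definition answer_of (s : state) (phi : iform) : option bool :=
  ohead [seq e.2 | e <- answers s & e.1 == phi].

Definition answered (s : state) (phi : iform) : bool := answer_of s phi != None.

Definition in_qtable (s : state) (q : query) : bool :=
  q \in [seq e.1 | e <- qtable s].

Definition set_clock (D : nat) (phi : iform) (s : state) : state :=
  if phi \in [seq c.1 | c <- clocks s] then s
  else State (now s) (qtable s) (rcons (clocks s) (phi, now s + 2 * D * clock_width phi))
         (answers s) (results s) (outbox s).

Definition waiting (s : state) (phi : iform) : bool :=
  has (fun c => (c.1 == phi) && (now s <= c.2)) (clocks s).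

Definition simp_not (phi : iform) : iform :=
  if phi is Truth b then Truth (~~ b) else Not phi.

Definition simp_and (phi psi : iform) : iform :=
  match phi, psi with
  | Truth b, _ => if b then psi else Truth false
  | _, Truth b => if b then phi else Truth false
  | _, _ => And phi psi
  end.

Definition simp_or (phi psi : iform) : iform :=
  match phi, psi with
  | Truth b, _ => if b then Truth true else psi
  | _, Truth b => if b then Truth true else phi
  | _, _ => Or phi psi
  end.

Definition simp_quant (e : bool) (x : var) (phi : iform) : iform :=
  if phi is Truth b then Truth b else Quant e x phi.

(** Atoms decided by the local data, and propagation of the truth values. *)
Fixpoint simplify (loc : local_data) (phi : iform) : iform :=
  match phi with
  | Truth b => Truth b
  | Adj s t =>
      match s, t with
      | Con b, Con c =>
          if ident_val b == own loc then Truth (ident_val c \in nbrs loc)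
          else if ident_val c == own loc then Truth (ident_val b \in nbrs loc)
          else Adj s t
      | _, _ => Adj s t
      end
  | Equal s t =>
      match s, t with
      | Con b, Con c => Truth (ident_val b == ident_val c)
      | _, _ => Equal s t
      end
  | Not phi => simp_not (simplify loc phi)
  | And phi psi => simp_and (simplify loc phi) (simplify loc psi)
  | Or phi psi => simp_or (simplify loc phi) (simplify loc psi)
  | Quant e x phi => simp_quant e x (simplify loc phi)
  end.

(** What an instance [b] of the Boolean query [phi] says about [phi]: only a
    witness or a counterevidence settles a quantified query; a quantifier-free
    query has the truth value of its simplification. *)
Definition verdict (phi : iform) (b : bool) : option bool :=
  match leftmost phi with
  | Some e => if b == e then Some b else None
  | None => Some b
  end.

(** [learn n phi b]: the node stores the answer [b] to [phi] and, if it is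
    waiting for it, evaluates the parent queries.  [n] bounds the length of the
    chain of parents. *)
Fixpoint learn (n : nat) (phi : iform) (b : bool) (s : state) : state :=
  if n is n'.+1 then
    if answered s phi then s
    else
      let s1 := record_answer phi b s in
      if waiting s phi then
        foldl (fun s' e =>
          if e.1 == BoolQ phi then
            match e.2 with
            | Some (BoolQ p) =>
                if verdict p b is Some b' then
                  if answered s' p then s'
                  else learn n' p b' (emit (Answer p b' 1) s')
                else s'
            | Some (PartQ _ vs _) => if b then record_result vs s' else s'
            | None => s'
            end
          else s') s1 (qtable s)
      else s1
  else s.

Definition learn_answer (phi : iform) (b : bool) (s : state) : state :=
  learn (size (qtable s)).+1 phi b s.

(** The subquery of [p] recorded with parent [p] has truth value [b]. *)
Definition resolve (p : query) (b : bool) (s : state) : state :=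
  match p with
  | BoolQ phi =>
      if verdict phi b is Some b' then
        if answered s phi then s
        else learn_answer phi b' (emit (Answer phi b' 1) s)
      else s
  | PartQ _ vs _ => if b then record_result vs s else s
  end.

(** The node issues ([p] is then the parent, if any) or receives the query
    [q].  [n] bounds the number of nested subqueries. *)
Fixpoint handle (n : nat) (loc : local_data) (q : query) (p : option query)
    (s : state) : state :=
  if n is n'.+1 then
    let issue_sub par phi s :=
      if phi is Truth b then resolve par b s
      else handle n' loc (BoolQ phi) (Some par) s in
    let fresh := ~~ in_qtable s q in
    let s1 := record_query q p s in
    let s2 :=
      match q, p with
      | BoolQ phi, Some par =>
          if answer_of s1 phi is Some b then resolve par b s1
          else set_clock (net_diam loc) phi s1
      | _, _ => s1
      end in
    if ~~ fresh then s2
    else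
      let s3 := emit (Query q) s2 in
      match q with
      | BoolQ phi =>
          if inst_leftmost (Ins (own loc)) phi is Some (_, psi) then
            issue_sub q (simplify loc psi) s3
          else
            let psi := simplify loc phi in
            if psi == phi then s3 else issue_sub q psi s3
      | PartQ [::] _ _ => s3
      | PartQ (x :: xs) vs phi =>
          let xs' := belast x xs in
          let vs' := own loc :: vs in
          let phi' := simplify loc (subst (last x xs) (Ins (own loc)) phi) in
          if xs' is [::] then issue_sub (PartQ [::] vs' phi') phi' s3
          else handle n' loc (PartQ xs' vs' phi') (Some q) s3
      end
  else s.

Definition handle_query (loc : local_data) (q : query) (p : option query) :
    state -> state :=
  let depth :=
    match q with
    | BoolQ phi => size (bound_vars phi)
    | PartQ xs _ phi => size xs + size (bound_vars phi)
    end in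
  handle depth.+2 loc q p.

Definition pose (loc : local_data) (r : fo_query U) (s : state) : state :=
  let phi := simplify loc (map_form Cst (qform r)) in
  if qvars r is [::] then
    if phi is Truth b then resolve (PartQ [::] [::] phi) b s
    else handle_query loc (BoolQ phi) (Some (PartQ [::] [::] phi)) s
  else handle_query loc (PartQ (qvars r) [::] phi) None s.

Definition receive_query (loc : local_data) (s : state) (m : message) : state :=
  if m is Query q then
    if in_qtable s q then s else handle_query loc q None s
  else s.

Definition hops (D : nat) (inbox : seq message) (phi : iform) : nat :=
  foldr (fun m k => if m is Answer psi _ h then
                      if psi == phi then minn h k else k
                    else k) D inbox.

Definition receive_answer (loc : local_data) (inbox : seq message) (s : state)
    (m : message) : state :=
  if m is Answer phi b _ then
    if answered s phi then s
    else
      let h := hops (net_diam loc) inbox phi in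
      learn_answer phi b
        (if h < net_diam loc then emit (Answer phi b h.+1) s else s)
  else s.

(** An elapsed clock settles the query for the waiting node itself; hence that
    answer is not sent, but the answer to the parent query, if settled, is.
    The narrower queries are treated first, as they may be subqueries of the
    others (relevant only if [Delta = 0]). *)
Definition elapse (s : state) : state :=
  let due := [seq c.1 | c <- clocks s & c.2 == now s] in
  foldl (fun s' phi =>
           if leftmost phi is Some e then learn_answer phi (~~ e) s' else s')
    s (sort (fun phi psi => clock_width phi <= clock_width psi) due).

(** One round of a node: [inbox] is what its neighbours broadcast in the
    previous round, [req] the query posed at the node in this round. *)
Definition node_round (loc : local_data) (req : option (fo_query U))
    (inbox : seq message) (s : state) : state :=
  let s0 := State (now s) (qtable s) (clocks s) (answers s) (results s) [::] in
  let s1 := if req is Some r then pose loc r s0 else s0 in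
  let s2 := foldl (receive_query loc) s1 inbox in
  let s3 := foldl (receive_answer loc inbox) s2 inbox in
  let s4 := elapse s3 in
  State (now s4).+1 (qtable s4) (clocks s4) (answers s4) (results s4) (outbox s4).

End Engine.

Arguments init_state {U}.

(** * Executions and distributed time *)

Section Execution.
Context (d : Order.disp_t) (U : orderType d) (D : nat) (G : network U D).
Context (Delta : nat) (r : U) (q : fo_query U).

Definition local_of (v : U) : local_data U :=
  LocalData v (neighbours G v) (size (nodes G)) Delta.

(** State of node [v] after [t] rounds, [q] being posed at [r] at the start. *)
Fixpoint execution (t : nat) (v : U) : state U :=
  if t is t'.+1 then
    node_round (local_of v) (if (t' == 0) && (v == r) then Some q else None)
      (flatten [seq outbox (execution t' u) | u <- neighbours G v])
      (execution t' v)
  else init_state.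

(** Some message is sent along an edge in round [t]. *)
Definition message_sent (t : nat) : Prop :=
  exists u v, [/\ u \in nodes G, edge G u v & outbox (execution t u) <> [::]].

Definition terminated_after (T : nat) : Prop :=
  forall t, T < t -> ~ message_sent t.

Definition is_distributed_time (T : nat) : Prop :=
  terminated_after T /\ forall T', terminated_after T' -> T <= T'.

End Execution.

(* Main.v *)
Require Import Defs.
From HB Require Import structures.
From mathcomp Require Import all_boot all_order.
From mathcomp Require Import zify.
From Stdlib Require Import Classical Wf_nat.

Set Implicit Arguments.
Unset Strict Implicit.
Unset Printing Implicit Defensive.

(** Let the width of a query be its number of variables and constants, the
    instantiated identifiers not being counted.  Every subquery is narrower than
    its parent: either a variable was instantiated, or the query is a
    quantifier-free sentence whose remaining atoms are adjacencies of constants,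
    and the simplifying node removed its own identifier from it.  A query is
    recorded by all nodes at most [Delta] rounds after it was first recorded
    anywhere, so a query of width [k] is first issued after at most
    [Delta * (w - k)] rounds, and its clock of [2 * Delta * k] rounds elapses
    after at most [Delta * (w + k)] rounds.  A node acts on the answer to a
    subquery only while the clock of that subquery runs; so an answer to a query
    of width [k > 0] originates at most [Delta * (w + k - 1)] rounds after the
    start, or is settled while the query itself is spreading, and it is forwarded
    over at most [Delta] hops, which ends by round [2 * Delta * w]. *)

(** * Formulas and their simplification *)

Section Formulas.
Context (C : eqType).
Implicit Types (phi psi a : form C) (c : C) (x : var).

Definition is_truth phi : bool := if phi is Truth _ then true else false.

Definition junction (b : bool) phi psi : form C :=
  if b then And phi psi else Or phi psi.

Fixpoint atoms phi : seq (form C) :=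
  match phi with
  | Truth _ | Adj _ _ | Equal _ _ => [:: phi]
  | Not phi => atoms phi
  | And phi psi | Or phi psi => atoms phi ++ atoms psi
  | Quant _ _ phi => atoms phi
  end.

Lemma atoms_junction b phi psi : atoms (junction b phi psi) = atoms phi ++ atoms psi.
Proof. by case: b. Qed.

Lemma size_atoms_gt0 phi : 0 < size (atoms phi).
Proof. by elim: phi => //= phi lt_phi psi _; rewrite size_cat ltn_addr. Qed.

Lemma atoms_atom phi a : a \in atoms phi -> atoms a = [:: a].
Proof.
elim: phi => //= [b|s t|s t|phi IH psi IH'|phi IH psi IH'];
  try by rewrite inE => /eqP ->.
all: by rewrite mem_cat => /orP[/IH|/IH'].
Qed.

Lemma consts_atoms phi : consts phi = flatten [seq consts a | a <- atoms phi].
Proof.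
by elim: phi => //= [s t|s t|phi -> psi ->|phi -> psi ->];
   rewrite ?cats0 // map_cat flatten_cat.
Qed.

Lemma free_vars_atoms phi a : bound_vars phi = [::] -> a \in atoms phi ->
  {subset free_vars a <= free_vars phi}.
Proof.
elim: phi => //= [b|s t|s t|phi IH psi IH'|phi IH psi IH'];
  try by rewrite inE => _ /eqP ->.
all: move/nilP; rewrite cat_nilp mem_cat => /andP[/nilP qf /nilP qf'].
all: by case/orP => [/(IH qf)|/(IH' qf')] sub y /sub; rewrite mem_cat => ->; rewrite ?orbT.
Qed.

Lemma free_vars_subst x c phi :
  free_vars (subst x c phi) = [seq y <- free_vars phi | y != x].
Proof.
have tvars_tsubst t : tvars (tsubst x c t) = [seq y <- tvars t | y != x].
  by case: t => //= y; case: eqP.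
elim: phi => //= [s t|s t|phi -> psi ->|phi -> psi ->|e y phi IH];
  rewrite ?filter_cat ?tvars_tsubst //.
case: eqP => [->|_]; first by rewrite filter_id.
by rewrite IH -!filter_predI; apply: eq_filter => z /=; rewrite andbC.
Qed.

Lemma bound_vars_subst x c phi : bound_vars (subst x c phi) = bound_vars phi.
Proof.
by elim: phi => //= [phi -> psi ->|phi -> psi ->|e y phi IH] //; case: eqP; rewrite ?IH.
Qed.

Lemma consts_subst x c phi : {subset consts (subst x c phi) <= c :: consts phi}.
Proof.
have tconsts_tsubst t : {subset tconsts (tsubst x c t) <= c :: tconsts t}.
  case: t => [y|i] j /=; first by case: ifP => //= _; rewrite inE.
  by move=> j_in; rewrite inE j_in orbT.
have cons_cat (r r' s s' : seq C) : {subset r <= c :: s} -> {subset r' <= c :: s'} ->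
    {subset r ++ r' <= c :: s ++ s'}.
  move=> sub sub' i; rewrite mem_cat inE mem_cat.
  by case/orP => [/sub|/sub']; rewrite inE => /orP[] ->; rewrite ?orbT.
elim: phi => //= [s t|s t|phi IH psi IH'|phi IH psi IH'|e y phi IH]; try exact: cons_cat.
by case: eqP => // _ i i_in; rewrite inE i_in orbT.
Qed.

Lemma mem_atoms_subst x c phi a : a \in atoms (subst x c phi) ->
  exists2 b, b \in atoms phi & a = b \/ a = subst x c b.
Proof.
elim: phi => //= [v|s t|s t|phi IH psi IH'|phi IH psi IH'|e y phi IH].
- by rewrite inE => /eqP ->; exists (Truth v); [rewrite inE|left].
- by rewrite inE => /eqP ->; exists (Adj s t); [rewrite inE|right].
- by rewrite inE => /eqP ->; exists (Equal s t); [rewrite inE|right].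
- by rewrite mem_cat => /orP[/IH|/IH'] [b b_in]; exists b; rewrite // mem_cat b_in ?orbT.
- by rewrite mem_cat => /orP[/IH|/IH'] [b b_in]; exists b; rewrite // mem_cat b_in ?orbT.
- by case: eqP => // _ a_in; exists a => //; left.
Qed.

Inductive leftmost_instance c : form C -> form C -> Prop :=
| InstNot phi phi' of leftmost_instance c phi phi' :
    leftmost_instance c (Not phi) (Not phi')
| InstLeft b phi phi' psi of leftmost_instance c phi phi' :
    leftmost_instance c (junction b phi psi) (junction b phi' psi)
| InstRight b phi psi psi' of leftmost_instance c psi psi' :
    leftmost_instance c (junction b phi psi) (junction b phi psi')
| InstQuant e x phi : leftmost_instance c (Quant e x phi) (subst x c phi).

Lemma inst_leftmost_instance c phi e psi :
  inst_leftmost c phi = Some (e, psi) -> leftmost_instance c phi psi.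
Proof.
have inst_junction b psi1 psi2 e0 chi :
    (forall e1 chi1, inst_leftmost c psi1 = Some (e1, chi1) -> leftmost_instance c psi1 chi1) ->
    (forall e2 chi2, inst_leftmost c psi2 = Some (e2, chi2) -> leftmost_instance c psi2 chi2) ->
    (if inst_leftmost c psi1 is Some (e1, chi1) then Some (e1, junction b chi1 psi2)
     else if inst_leftmost c psi2 is Some (e2, chi2) then Some (e2, junction b psi1 chi2)
     else None) = Some (e0, chi) -> leftmost_instance c (junction b psi1 psi2) chi.
  case: inst_leftmost => [[e1 chi1] /(_ _ _ erefl) inst1 _ [_ <-]|_]; first exact: InstLeft.
  by case: inst_leftmost => // -[e2 chi2] /(_ _ _ erefl) inst2 [_ <-]; apply: InstRight.
elim: phi e psi => //= [phi IH|phi IH psi IH'|phi IH psi IH'|e' x phi _] e chi.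
- by case: inst_leftmost IH => // -[e' phi'] /(_ _ _ erefl) IH [_ <-]; constructor.
- exact: (inst_junction true) IH IH'.
- exact: (inst_junction false) IH IH'.
- by case=> _ <-; constructor.
Qed.

Lemma inst_leftmost_None c phi : inst_leftmost c phi = None -> bound_vars phi = [::].
Proof.
elim: phi => //= [phi|phi IH psi IH'|phi IH psi IH'].
- by case: inst_leftmost => [[]|].
- by case: inst_leftmost IH => [[]|] // ->; case: inst_leftmost IH' => [[]|] // ->.
- by case: inst_leftmost IH => [[]|] // ->; case: inst_leftmost IH' => [[]|] // ->.
Qed.

Lemma free_vars_instance c phi psi :
  leftmost_instance c phi psi -> {subset free_vars psi <= free_vars phi}.
Proof.
elim=> // [b phi0 phi' chi _ sub|b chi psi0 psi' _ sub|e x phi0] y.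
- by case: b; rewrite /= !mem_cat => /orP[/sub|] ->; rewrite ?orbT.
- by case: b; rewrite /= !mem_cat => /orP[|/sub] ->; rewrite ?orbT.
- by rewrite free_vars_subst.
Qed.

Lemma size_bound_vars_instance c phi psi :
  leftmost_instance c phi psi -> size (bound_vars phi) = (size (bound_vars psi)).+1.
Proof.
elim=> //= [b phi0 phi' chi _ eq_size|b chi psi0 psi' _ eq_size|e x phi0].
- by case: b; rewrite /= !size_cat eq_size.
- by case: b; rewrite /= !size_cat eq_size addnS.
- by rewrite bound_vars_subst.
Qed.

Lemma consts_instance c phi psi :
  leftmost_instance c phi psi -> {subset consts psi <= c :: consts phi}.
Proof.
elim=> // [b phi0 phi' chi _ sub|b chi psi0 psi' _ sub|e x phi0] y.
- by case: b => /=; rewrite inE !mem_cat => /orP[/sub|->];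
     rewrite ?inE ?orbT // => /orP[] ->; rewrite ?orbT.
- by case: b => /=; rewrite inE !mem_cat => /orP[->|/sub];
     rewrite ?inE ?orbT // => /orP[] ->; rewrite ?orbT.
- exact: consts_subst.
Qed.

Lemma mem_atoms_instance c phi psi a : leftmost_instance c phi psi -> a \in atoms psi ->
  exists2 b, b \in atoms phi & a = b \/ exists x, a = subst x c b.
Proof.
elim=> // [v phi0 phi' chi _ IH|v chi psi0 psi' _ IH|e x phi0]; rewrite ?atoms_junction.
- rewrite mem_cat => /orP[/IH[b b_in eq_a]|a_in].
    by exists b; rewrite // mem_cat b_in.
  by exists a; [rewrite mem_cat a_in orbT|left].
- rewrite mem_cat => /orP[a_in|/IH[b b_in eq_a]].
    by exists a; [rewrite mem_cat a_in|left].
  by exists b; rewrite // mem_cat b_in orbT.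
- by move=> /mem_atoms_subst[b b_in [->|->]]; exists b => //; [left|right; exists x].
Qed.

End Formulas.

Section MapForm.
Context (A B : Type) (f : A -> B).

Lemma bound_vars_map_form phi : bound_vars (map_form f phi) = bound_vars phi.
Proof. by elim: phi => //= [phi -> psi ->|phi -> psi ->|e x phi ->]. Qed.

Lemma free_vars_map_form phi : free_vars (map_form f phi) = free_vars phi.
Proof.
by elim: phi => //= [[x|i] [y|j]|[x|i] [y|j]|phi -> psi ->|phi -> psi ->|e x phi ->].
Qed.

Lemma consts_map_form phi : consts (map_form f phi) = [seq f c | c <- consts phi].
Proof.
by elim: phi => //= [[x|i] [y|j]|[x|i] [y|j]|phi -> psi ->|phi -> psi ->] //;
   rewrite map_cat.
Qed.

End MapForm.

Section EngineFormulas.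
Context (U : eqType).
Implicit Types (phi psi a : form (ident U)) (loc : local_data U).

Inductive reduct loc : form (ident U) -> form (ident U) -> Prop :=
| ReductTruth phi b : reduct loc phi (Truth b)
| ReductAtom a of atoms a = [:: a] & simplify loc a = a : reduct loc a a
| ReductNot phi phi' of ~~ is_truth phi' & reduct loc phi phi' :
    reduct loc (Not phi) (Not phi')
| ReductLeft b phi phi' psi of reduct loc phi phi' : reduct loc (junction b phi psi) phi'
| ReductRight b phi psi psi' of reduct loc psi psi' : reduct loc (junction b phi psi) psi'
| ReductBoth b phi phi' psi psi' of ~~ is_truth phi' & ~~ is_truth psi' &
    reduct loc phi phi' & reduct loc psi psi' :
    reduct loc (junction b phi psi) (junction b phi' psi')
| ReductQuant e x phi phi' of ~~ is_truth phi' & reduct loc phi phi' :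
    reduct loc (Quant e x phi) (Quant e x phi').

Variant simp_junction_spec b phi psi : form (ident U) -> Prop :=
| SimpTruth v : simp_junction_spec b phi psi (Truth v)
| SimpLeft : simp_junction_spec b phi psi phi
| SimpRight : simp_junction_spec b phi psi psi
| SimpBoth of ~~ is_truth phi & ~~ is_truth psi :
    simp_junction_spec b phi psi (junction b phi psi).

Lemma simp_andP phi psi : simp_junction_spec true phi psi (simp_and phi psi).
Proof.
by case: phi => [[]|? ?|? ?|?|? ?|? ?|? ? ?]; case: psi => [[]|? ?|? ?|?|? ?|? ?|? ? ?] /=;
   first [exact: SimpBoth | constructor].
Qed.

Lemma simp_orP phi psi : simp_junction_spec false phi psi (simp_or phi psi).
Proof.
by case: phi => [[]|? ?|? ?|?|? ?|? ?|? ? ?]; case: psi => [[]|? ?|? ?|?|? ?|? ?|? ? ?] /=;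
   first [exact: SimpBoth | constructor].
Qed.

Lemma simplify_reduct loc phi : reduct loc phi (simplify loc phi).
Proof.
have reduct_junction b psi chi psi' chi' xi : reduct loc psi psi' -> reduct loc chi chi' ->
    simp_junction_spec b psi' chi' xi -> reduct loc (junction b psi chi) xi.
  move=> psi_psi' chi_chi' [v|||psi'_ntruth chi'_ntruth].
  - exact: ReductTruth.
  - exact: ReductLeft.
  - exact: ReductRight.
  - exact: ReductBoth.
have reduct_atom a : atoms a = [:: a] ->
    is_truth (simplify loc a) || (simplify loc a == a) -> reduct loc a (simplify loc a).
  move=> eq_atoms /orP[|/eqP fixed]; last by rewrite fixed; apply: ReductAtom.
  by case: simplify => // b _; apply: ReductTruth.
elim: phi => [v|s t|s t|phi IH|phi IH psi IH'|phi IH psi IH'|e x phi IH].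
- exact: ReductTruth.
- apply: reduct_atom => //; case: s t => [x|i] [y|j] /=; rewrite ?eqxx //.
  by do 2?[case: ifP => // _]; rewrite eqxx.
- by apply: reduct_atom => //; case: s t => [x|i] [y|j] /=; rewrite ?eqxx.
- by rewrite /=; case: simplify IH => *; first [exact: ReductTruth | exact: ReductNot].
- exact: reduct_junction IH IH' (simp_andP _ _).
- exact: reduct_junction IH IH' (simp_orP _ _).
- by rewrite /=; case: simplify IH => *; first [exact: ReductTruth | exact: ReductQuant].
Qed.

Lemma free_vars_simplify loc phi : {subset free_vars (simplify loc phi) <= free_vars phi}.
Proof.
elim: (simplify_reduct loc phi) => {phi} //
  [a _ _|b phi phi' psi _ sub|b phi psi psi' _ sub|b phi phi' psi psi' _ _ _ sub _ sub'
  |e x phi phi' _ _ sub] y //.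
- by move/sub; case: b => /=; rewrite mem_cat => ->.
- by move/sub; case: b => /=; rewrite mem_cat => ->; rewrite orbT.
- by case: b => /=; rewrite !mem_cat => /orP[/sub|/sub'] ->; rewrite ?orbT.
- by rewrite !mem_filter => /andP[-> /sub].
Qed.

Lemma leq_size_bound_vars_simplify loc phi :
  size (bound_vars (simplify loc phi)) <= size (bound_vars phi).
Proof.
elim: (simplify_reduct loc phi) => {phi} //
  [b phi phi' psi _ le_size|b phi psi psi' _ le_size
  |b phi phi' psi psi' _ _ _ le_size _ le_size'].
all: case: b; rewrite /= !size_cat ?leq_add //; lia.
Qed.

Definition fixed_atom loc a : bool := ~~ is_truth a && (simplify loc a == a).

Lemma atoms_simplify loc phi : ~~ is_truth (simplify loc phi) ->
  {in atoms (simplify loc phi), forall a, a \in atoms phi /\ fixed_atom loc a}.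
Proof.
elim: (simplify_reduct loc phi) => {phi} //
  [a eq_atoms fixed ntruth|phi phi' ntruth _ IH _|b phi phi' psi _ IH ntruth
  |b phi psi psi' _ IH ntruth|b phi phi' psi psi' ntruth ntruth' _ IH _ IH' _
  |e x phi phi' ntruth _ IH _] a'; rewrite ?atoms_junction.
- by rewrite eq_atoms inE => /eqP ->; rewrite /fixed_atom ntruth fixed !eqxx.
- exact: IH.
- by rewrite mem_cat => /(IH ntruth)[-> ->].
- by rewrite mem_cat => /(IH ntruth)[-> ->]; rewrite orbT.
- by rewrite !mem_cat => /orP[/(IH ntruth)|/(IH' ntruth')] [-> ->]; rewrite ?orbT.
- exact: IH.
Qed.

Lemma consts_simplify loc phi : {subset consts (simplify loc phi) <= consts phi}.
Proof.
have [|ntruth] := boolP (is_truth (simplify loc phi)); first by case: simplify.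
move=> i; rewrite !consts_atoms => /flatten_mapP[a /(atoms_simplify ntruth)[a_in _] i_in].
by apply/flatten_mapP; exists a.
Qed.

Lemma simplify_id loc phi : all (fixed_atom loc) (atoms phi) -> simplify loc phi = phi.
Proof.
suff id_ntruth : all (fixed_atom loc) (atoms phi) -> simplify loc phi = phi /\ ~~ is_truth phi.
  by move/id_ntruth => [].
rewrite /fixed_atom; elim: phi => [v|s t|s t|phi IH|phi IH psi IH'|phi IH psi IH'|e x phi IH] //.
- by rewrite /= andbT => /eqP.
- by rewrite /= andbT => /eqP.
- by move=> /IH[/= ->]; case: (phi).
- rewrite /= all_cat => /andP[/IH[-> ntruth] /IH'[-> ntruth']].
  by case: (phi) ntruth; case: (psi) ntruth'.
- rewrite /= all_cat => /andP[/IH[-> ntruth] /IH'[-> ntruth']].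
  by case: (phi) ntruth; case: (psi) ntruth'.
- by move=> /IH[/= ->]; case: (phi).
Qed.

Definition is_cst (i : ident U) : bool := if i is Cst _ then true else false.

(* In a simplified query, the adjacencies of two identifiers are between constants
   of the posed query: the node that replaces the last variable of any other
   adjacency by its own identifier decides it. *)
Definition stable_atom a : bool :=
  match a with
  | Adj (Con i) (Con j) => is_cst i && is_cst j
  | Adj _ _ => true
  | Equal (Con _) (Con _) => false
  | Equal _ _ => true
  | _ => false
  end.

Definition normal phi : bool := all stable_atom (atoms phi).

Definition simplified phi : bool := is_truth phi || normal phi.

Lemma simplified_simplify loc phi :
  {in atoms phi, forall a, simplified (simplify loc a)} -> simplified (simplify loc phi).
Proof.
move=> simpl_atoms; rewrite /simplified; case: (boolP (is_truth _)) => //= ntruth.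
apply/allP => a /(atoms_simplify ntruth)[a_phi /andP[a_ntruth /eqP fixed]].
have := simpl_atoms a a_phi; rewrite fixed /simplified (negPf a_ntruth) /=.
by rewrite /normal (atoms_atom a_phi) /= andbT.
Qed.

Lemma stable_simplify loc a : stable_atom a -> simplified (simplify loc a).
Proof.
by case: a => // -[x|[c|v]] // [y|[c'|v']] //= _; do 2?[case: ifP => //].
Qed.

Lemma stable_simplify_subst loc x a :
  stable_atom a -> simplified (simplify loc (subst x (Ins (own loc)) a)).
Proof.
by case: a => // -[y|[c|v]] // [z|[c'|v']] //= _; do ?[rewrite ?eqxx //=; case: ifP => //= _].
Qed.

Lemma simplified_simplify_normal loc phi : normal phi -> simplified (simplify loc phi).
Proof.
by move=> /allP normal_phi; apply: simplified_simplify => a /normal_phi/stable_simplify.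
Qed.

Lemma simplified_simplify_subst loc x phi :
  simplified phi -> simplified (simplify loc (subst x (Ins (own loc)) phi)).
Proof.
case/orP => [|/allP normal_phi]; first by case: phi.
apply: simplified_simplify => a /mem_atoms_subst[b /normal_phi b_stable [->|->]].
  exact: stable_simplify.
exact: stable_simplify_subst.
Qed.

Lemma simplified_simplify_instance loc phi psi : normal phi ->
  leftmost_instance (Ins (own loc)) phi psi -> simplified (simplify loc psi).
Proof.
move=> /allP normal_phi phi_psi; apply: simplified_simplify => a a_psi.
have [b /normal_phi b_stable [->|[x ->]]] := mem_atoms_instance phi_psi a_psi.
  exact: stable_simplify.
exact: stable_simplify_subst.
Qed.

Lemma simplified_simplify_map_form loc (phi : form U) :
  simplified (simplify loc (map_form (@Cst U) phi)).
Proof.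
apply: simplified_simplify; elim: phi => [v|[x|c] [y|c']|[x|c] [y|c']|phi IH|phi IH psi IH'
  |phi IH psi IH'|e x phi IH] a //=; rewrite ?inE ?mem_cat.
all: first [exact: IH | by case/orP => [/IH|/IH'] | by move=> /eqP -> /=; do 2?[case: ifP => _]].
Qed.

Definition posed_consts phi : seq U := flatten [seq ident_cst i | i <- consts phi].

Lemma clock_widthE phi :
  clock_width phi = size (bound_vars phi) + size (undup (posed_consts phi)).
Proof. by []. Qed.

Lemma mem_posed_consts phi c : (c \in posed_consts phi) = (Cst c \in consts phi).
Proof.
apply/flatten_mapP/idP => [[[c'|v] in_phi]|in_phi] //=; last by exists (Cst c); rewrite ?mem_head.
by rewrite inE => /eqP ->.
Qed.

Lemma leq_size_posed_consts phi psi :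
  (forall c, Cst c \in consts phi -> Cst c \in consts psi) ->
  size (undup (posed_consts phi)) <= size (undup (posed_consts psi)).
Proof.
move=> sub; apply: uniq_leq_size (undup_uniq _) _ => c.
by rewrite !mem_undup !mem_posed_consts => /sub.
Qed.

Lemma leq_clock_width phi psi : size (bound_vars phi) <= size (bound_vars psi) ->
  (forall c, Cst c \in consts phi -> Cst c \in consts psi) -> clock_width phi <= clock_width psi.
Proof. by move=> le_bound sub; rewrite !clock_widthE leq_add ?leq_size_posed_consts. Qed.

Lemma leq_clock_width_simplify loc phi : clock_width (simplify loc phi) <= clock_width phi.
Proof.
apply: leq_clock_width => [|c]; [exact: leq_size_bound_vars_simplify | exact: consts_simplify].
Qed.

Lemma leq_clock_width_subst x v phi : clock_width (subst x (Ins v) phi) <= clock_width phi.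
Proof. by apply: leq_clock_width => [|c /consts_subst //]; rewrite bound_vars_subst. Qed.

Lemma ltn_clock_width_instance v phi psi :
  leftmost_instance (Ins v) phi psi -> clock_width psi < clock_width phi.
Proof.
move=> phi_psi; rewrite !clock_widthE (size_bound_vars_instance phi_psi) ltnS leq_add2l.
by apply: leq_size_posed_consts => c /(consts_instance phi_psi).
Qed.

Definition sentence phi : Prop := {subset free_vars phi <= [::]}.

Lemma normal_atom_adj phi a : normal phi -> sentence phi -> bound_vars phi = [::] ->
  a \in atoms phi -> exists b c, a = Adj (Con (Cst b)) (Con (Cst c)).
Proof.
move=> /allP normal_phi closed_phi qfree a_phi.
have closed_a : sentence a by move=> x /(free_vars_atoms qfree a_phi)/closed_phi.
case: a {a_phi} (normal_phi a a_phi) closed_a => // -[x|[b|v]] [y|[c|v']] //= _ closed_a;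
  try by [have := closed_a x (mem_head _ _) | have := closed_a y (mem_head _ _)].
by exists b, c.
Qed.

Lemma clock_width_gt0 phi : normal phi -> sentence phi -> 0 < clock_width phi.
Proof.
move=> normal_phi closed_phi; rewrite clock_widthE addn_gt0.
case: (posnP (size (bound_vars phi))) => //= /size0nil qfree.
have [a a_phi] : exists a, a \in atoms phi.
  by case: (atoms phi) (size_atoms_gt0 phi) => // a r _; exists a; apply: mem_head.
have [b [c eq_a]] := normal_atom_adj normal_phi closed_phi qfree a_phi.
have : b \in undup (posed_consts phi).
  rewrite mem_undup mem_posed_consts consts_atoms; apply/flatten_mapP.
  by exists a => //; rewrite eq_a mem_head.
by case: undup.
Qed.

Lemma own_notin_consts_simplify loc phi : normal phi -> sentence phi ->
  bound_vars phi = [::] -> Cst (own loc) \notin consts (simplify loc phi).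
Proof.
move=> normal_phi closed_phi qfree.
have [|ntruth] := boolP (is_truth (simplify loc phi)); first by case: simplify.
rewrite consts_atoms; apply/flatten_mapP => -[a /(atoms_simplify ntruth)[a_phi /andP[_ /eqP]]].
have [b [c ->]] := normal_atom_adj normal_phi closed_phi qfree a_phi.
rewrite /= !inE; case: ifP => // b_own; case: ifP => // c_own _.
by case/orP => /eqP[own_eq]; rewrite own_eq eqxx in b_own c_own.
Qed.

Lemma simplify_own_notin_consts loc phi : normal phi -> sentence phi ->
  bound_vars phi = [::] -> Cst (own loc) \notin consts phi -> simplify loc phi = phi.
Proof.
move=> normal_phi closed_phi qfree own_out; apply/simplify_id/allP => a a_phi.
have [b [c eq_a]] := normal_atom_adj normal_phi closed_phi qfree a_phi.
have : Cst (own loc) \notin consts a.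
  by apply: contra own_out => own_a; rewrite consts_atoms; apply/flatten_mapP; exists a.
rewrite eq_a /= !inE negb_or /fixed_atom /=.
by have [->|_] := eqVneq b; [rewrite eqxx | have [->|_] := eqVneq c; rewrite eqxx ?andbF].
Qed.

Lemma ltn_clock_width_simplify loc phi : normal phi -> sentence phi ->
  bound_vars phi = [::] -> simplify loc phi != phi ->
  clock_width (simplify loc phi) < clock_width phi.
Proof.
move=> normal_phi closed_phi qfree neq.
have own_out := own_notin_consts_simplify loc normal_phi closed_phi qfree.
have own_in : Cst (own loc) \in consts phi.
  by apply: contra_neqT neq; apply: simplify_own_notin_consts.
rewrite !clock_widthE -addnS leq_add ?leq_size_bound_vars_simplify //.
set other_consts := undup (posed_consts (simplify loc phi)).
suff : size (own loc :: other_consts) <= size (undup (posed_consts phi)) by [].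
apply: uniq_leq_size => [|c]; rewrite /= ?undup_uniq ?inE !mem_undup !mem_posed_consts.
  by rewrite own_out.
by case/orP => [/eqP ->|/consts_simplify].
Qed.

End EngineFormulas.

(** * Steps of the query engine *)

Definition message_eq_dec (U : eqType) : comparable (message U).
Proof.
by rewrite /comparable /decidable; decide equality;
   first [exact: eq_comparable | exact: form_eq_dec].
Defined.
HB.instance Definition _ (U : eqType) :=
  hasDecEq.Build (message U) (compareP (@message_eq_dec U)).

Lemma foldl_invariant (S : Type) (T : eqType) (P : S -> Prop) (f : S -> T -> S) z r :
  P z -> (forall y x, x \in r -> P y -> P (f y x)) -> P (foldl f z r).
Proof.
elim: r z => //= x r IH z Pz Pf; apply: IH => [|y x' x'_r]; apply: Pf => //.
  exact: mem_head.
by rewrite inE x'_r orbT.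
Qed.

Section EngineSteps.
Context (U : eqType).
Implicit Types (phi psi : form (ident U)) (q par : query U) (p : option (query U)).
Implicit Types (loc : local_data U) (s : state U) (b : bool).

Definition silence s : state U :=
  State (now s) (qtable s) (clocks s) (answers s) (results s) [::].

Definition tick s : state U :=
  State (now s).+1 (qtable s) (clocks s) (answers s) (results s) (outbox s).

Definition settled q : bool := if q is BoolQ phi then is_truth phi else false.

(* The subquery that a node generates from [q], with its parent. *)
Definition child loc q : option (query U * query U) :=
  match q with
  | BoolQ phi =>
      if inst_leftmost (Ins (own loc)) phi is Some (_, psi) then
        Some (BoolQ (simplify loc psi), q)
      else if simplify loc phi == phi then None
      else Some (BoolQ (simplify loc phi), q)
  | PartQ [::] _ _ => None
  | PartQ (x :: xs) vs phi =>
      let xs' := belast x xs in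
      let vs' := own loc :: vs in
      let phi' := simplify loc (subst (last x xs) (Ins (own loc)) phi) in
      if xs' is [::] then Some (BoolQ phi', PartQ [::] vs' phi')
      else Some (PartQ xs' vs' phi', q)
  end.

Definition first_query loc (r : fo_query U) : query U * option (query U) :=
  let phi := simplify loc (map_form (@Cst U) (qform r)) in
  if qvars r is [::] then (BoolQ phi, Some (PartQ [::] [::] phi))
  else (PartQ (qvars r) [::] phi, None).

Definition issue n loc q p s : state U :=
  match q, p with
  | BoolQ (Truth b), Some par => resolve par b s
  | _, _ => handle n loc q p s
  end.

Definition await (k : nat) q p s : state U :=
  match q, p with
  | BoolQ phi, Some par =>
      if answer_of s phi is Some b then resolve par b s else set_clock k phi s
  | _, _ => s
  end.

Definition enter (k : nat) q p s : state U :=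
  let s' := await k q p (record_query q p s) in
  if in_qtable s q then s' else emit (Query q) s'.

Lemma handleS n loc q p s :
  handle n.+1 loc q p s =
  let s' := enter (net_diam loc) q p s in
  if in_qtable s q then s'
  else if child loc q is Some (q', par) then issue n loc q' (Some par) s' else s'.
Proof.
cbn [handle]; rewrite /enter -/(await _ q p _) negbK; case: ifP => // _.
case: q => [phi|[|x xs] vs phi] //=.
- case: inst_leftmost => [[e psi]|]; first by case: simplify.
  by case: ifP => // _; case: simplify.
- by case: belast => //; case: simplify.
Qed.

Lemma issue_unsettled n loc q p s :
  ~~ settled q -> issue n loc q p s = handle n loc q p s.
Proof. by case: q => [[]|]. Qed.

Lemma poseE loc r s :
  let (q, p) := first_query loc r in exists n, pose loc r s = issue n.+1 loc q p s.
Proof.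
rewrite /first_query /pose /handle_query; case: qvars => [|x xs]; last by eexists.
by case: simplify => *; first [by exists 0 | by eexists].
Qed.

Lemma hops_mem k (inbox : seq (message U)) phi :
  hops k inbox phi < k -> exists b, Answer phi b (hops k inbox phi) \in inbox.
Proof.
elim: inbox => [|[q|psi b h] inbox IH] /=; first by rewrite ltnn.
  by move/IH => [b b_in]; exists b; rewrite inE b_in orbT.
case: eqP => [->|_]; last by move/IH => [b' b_in]; exists b'; rewrite inE b_in orbT.
rewrite /minn; case: ifP => _ lt_h; first by exists b; rewrite mem_head.
by have [b' b_in] := IH lt_h; exists b'; rewrite inE b_in orbT.
Qed.

Record answer_closed (P : state U -> Prop) : Prop := AnswerClosed {
  closed_record_answer : forall s phi b, P s -> P (record_answer phi b s);
  closed_record_result : forall s vs, P s -> P (record_result vs s);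
  closed_emit_parent : forall s phi psi b,
    (BoolQ phi, Some (BoolQ psi)) \in qtable s -> waiting s phi ->
    P s -> P (emit (Answer psi b 1) s)
}.

(* [ok q p]: a node may enter the query [q] with parent [p] into its table. *)
Record query_closed loc (P : state U -> Prop) (ok : query U -> option (query U) -> Prop) :
    Prop := QueryClosed {
  closed_enter : forall s q p, ok q p -> P s -> P (enter (net_diam loc) q p s);
  closed_emit_answer : forall s q p phi b, ok q p -> P s -> P (emit (Answer phi b 1) s);
  closed_child : forall q p q' par, ok q p -> child loc q = Some (q', par) ->
    ~~ settled q' -> ok q' (Some par)
}.

Section Closure.
Context (P : state U -> Prop) (P_answer : answer_closed P).

Lemma learn_closed n phi b s : P s -> P (learn n phi b s).
Proof.
(* The table and the clocks are not changed, so the parents found in the table at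
   the start still meet [closed_emit_parent] when they are answered. *)
pose core s' := (now s', qtable s', clocks s').
move=> Ps; suff: P (learn n phi b s) /\ core (learn n phi b s) = core s by case.
elim: n phi b s Ps => //= n IH phi b s Ps.
have Ps1 := closed_record_answer P_answer phi b Ps.
case: ifP => // _; case: ifP => [wait|//].
apply: (foldl_invariant (P := fun s' => P s' /\ core s' = core s)) => //.
move=> s' [q p] in_s [Ps' core_s'].
have [now_s' qtable_s' clocks_s'] := core_s'.
case: eqP in_s => //= -> in_s; case: p in_s => // [[psi|xs vs psi]] in_s.
  case: verdict => // b'; case: ifP => // _.
  have [|P_learn ->] := IH psi b' (emit (Answer psi b' 1) s'); last by [].
  apply: (closed_emit_parent P_answer _ _ _ Ps'); first by rewrite qtable_s'; exact: in_s.
  by rewrite /waiting now_s' clocks_s'.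
case: b {Ps1} => //; split; first exact: (closed_record_result P_answer).
by rewrite -core_s' /record_result; case: ifP.
Qed.

Lemma resolve_closed par b s : (forall phi b', P (emit (Answer phi b' 1) s)) -> P s ->
  P (resolve par b s).
Proof.
case: par => [phi|xs vs phi] Pemit Ps /=.
  by case: verdict => // b'; case: ifP => // _; apply: learn_closed.
by case: b => //; apply: (closed_record_result P_answer).
Qed.

Lemma elapse_closed s : P s -> P (elapse s).
Proof.
move=> Ps; apply: foldl_invariant => // s' phi _ Ps'; case: leftmost => // e.
exact: learn_closed.
Qed.

Context (loc : local_data U).

Lemma issue_closed n q par s :
  (~~ settled q -> P (handle n loc q (Some par) s)) ->
  (forall phi b, P (emit (Answer phi b 1) s)) -> P s -> P (issue n loc q (Some par) s).
Proof.
move=> Phandle Pemit Ps; have [|unsettled] := boolP (settled q).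
  by case: q {Phandle} => [[b| | | | | |]|] //= _; apply: resolve_closed.
by rewrite issue_unsettled //; apply: Phandle.
Qed.

Context (ok : query U -> option (query U) -> Prop) (P_query : query_closed loc P ok).

Lemma handle_closed n q p s : ok q p -> P s -> P (handle n loc q p s).
Proof.
elim: n q p s => // n IH q p s ok_q Ps; rewrite handleS /=.
have Ps' := closed_enter P_query ok_q Ps.
case: ifP => // _; case q_child: child => [[q' par]|] //.
apply: issue_closed => // [unsettled|phi b].
  by apply: IH => //; apply: (closed_child P_query ok_q q_child unsettled).
exact: (closed_emit_answer P_query _ _ ok_q Ps').
Qed.

Lemma pose_closed (r : fo_query U) s :
  (let (q, p) := first_query loc r in ~~ settled q -> ok q p) -> P s -> P (pose loc r s).
Proof.
have := poseE loc r s; rewrite /first_query; case: qvars => [|x xs] [n ->] ok_first Ps.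
  have [|unsettled] := boolP (settled (BoolQ (simplify loc (map_form (@Cst U) (qform r))))).
    by rewrite /issue; case: simplify => //= -[] _ //; apply: (closed_record_result P_answer).
  by rewrite issue_unsettled //; apply: handle_closed => //; apply: ok_first.
by apply: handle_closed => //; apply: ok_first.
Qed.

Lemma receive_query_closed m s :
  (forall q, m = Query q -> ~~ in_qtable s q -> ok q None) -> P s -> P (receive_query loc s m).
Proof.
case: m => //= q ok_q Ps; case: ifP => // /negbT fresh.
by apply: handle_closed => //; apply: ok_q.
Qed.

Definition forward_closed (inbox : seq (message U)) : Prop :=
  forall s phi b b' h, Answer phi b h \in inbox -> h < net_diam loc ->
    P s -> P (emit (Answer phi b' h.+1) s).

Lemma receive_answer_closed inbox m s :
  forward_closed inbox -> P s -> P (receive_answer loc inbox s m).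
Proof.
case: m => //= phi b _ P_forward Ps; case: ifP => // _; apply: learn_closed.
case: ifP => // lt_hops; have [b' in_inbox] := hops_mem lt_hops.
exact: P_forward in_inbox _ _.
Qed.

Lemma node_round_closed req inbox s :
  (forall r, req = Some r -> let (q, p) := first_query loc r in ~~ settled q -> ok q p) ->
  (forall s' q, Query q \in inbox -> P s' -> ~~ in_qtable s' q -> ok q None) ->
  forward_closed inbox -> P (silence s) ->
  exists2 s', P s' & node_round loc req inbox s = tick s'.
Proof.
move=> ok_first ok_received P_forward Ps; rewrite /node_round -/(silence s).
eexists; last by [].
apply: elapse_closed; apply: foldl_invariant => [|s' m _]; last exact: receive_answer_closed.
apply: foldl_invariant => [|s' m m_in Ps'].
  by case: req ok_first => // r /(_ r erefl) ok_r; apply: pose_closed.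
by apply: receive_query_closed => // q eq_m; apply: ok_received => //; rewrite -eq_m.
Qed.

End Closure.

(* A query enters the table only together with its broadcast. *)
Definition extends s s' : Prop :=
  [/\ {subset qtable s <= qtable s'}, {subset outbox s <= outbox s'} &
      forall q, in_qtable s' q -> in_qtable s q || (Query q \in outbox s')].

Lemma extends_refl s : extends s s.
Proof. by split=> // q ->. Qed.

Lemma extends_trans s2 s1 s3 : extends s1 s2 -> extends s2 s3 -> extends s1 s3.
Proof.
move=> [table12 box12 new12] [table23 box23 new23].
split=> [e /table12/table23|m /box12/box23|q /new23] //.
by case/orP => [/new12/orP[->|/box23 ->]|->]; rewrite ?orbT.
Qed.

Lemma extends_in_qtable s s' q : extends s s' -> in_qtable s q -> in_qtable s' q.
Proof. by case=> sub_table _ _ /mapP[e /sub_table e_in ->]; apply: map_f. Qed.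

Lemma mem_outbox_emit m m' s : (m' \in outbox (emit m s)) = (m' == m) || (m' \in outbox s).
Proof. by rewrite /= mem_rcons inE. Qed.

Lemma emit_extends m s : extends s (emit m s).
Proof.
split=> [//|m' m'_s|q q_s]; first by rewrite mem_outbox_emit m'_s orbT.
by apply/orP; left.
Qed.

Lemma extends_answer_closed s : answer_closed (extends s).
Proof.
split=> [s' phi b ext|s' vs ext|s' phi psi b _ _ ext].
- exact: extends_trans ext (extends_refl _).
- by rewrite /record_result; case: ifP.
- exact: extends_trans ext (emit_extends _ _).
Qed.

Lemma await_extends k q p s : extends s (await k q p s).
Proof.
case: q p => [phi|xs vs phi] [par|]; try exact: extends_refl.
rewrite /=; case: answer_of => [b|]; last first.
  by rewrite /set_clock; case: ifP => _; apply: extends_refl.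
apply: (resolve_closed (extends_answer_closed s)); last exact: extends_refl.
by move=> *; apply: emit_extends.
Qed.

Lemma in_qtable_record_query q q' p s :
  in_qtable (record_query q p s) q' = (q' == q) || in_qtable s q'.
Proof.
rewrite /record_query; case: ifP => [qp_s|_]; last by rewrite /in_qtable map_rcons mem_rcons inE.
by case: eqP => // ->; apply/mapP; exists (q, p).
Qed.

Lemma in_qtable_enter k q p s : in_qtable (enter k q p s) q.
Proof.
have : in_qtable (await k q p (record_query q p s)) q.
  by apply: extends_in_qtable (await_extends _ _ _ _) _; rewrite in_qtable_record_query eqxx.
by rewrite /enter; case: ifP.
Qed.

Lemma enter_extends k q p s : extends s (enter k q p s).
Proof.
have [table_await box_await new_await] := await_extends k q p (record_query q p s).
have table : {subset qtable s <= qtable (await k q p (record_query q p s))}.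
  move=> e e_s; apply: table_await; rewrite /record_query; case: ifP => //= _.
  by rewrite mem_rcons inE e_s orbT.
have box : {subset outbox s <= outbox (await k q p (record_query q p s))}.
  by move=> m m_s; apply: box_await; rewrite /record_query; case: ifP.
rewrite /enter; case: ifP => [q_s|_].
  split=> // q' /new_await; rewrite in_qtable_record_query.
  by case/orP => [/predU1P[->|->]|->]; rewrite ?q_s ?orbT.
split=> [//|m m_s|q' /new_await]; rewrite mem_outbox_emit; first by rewrite box ?orbT.
by rewrite in_qtable_record_query => /orP[/predU1P[->|->]|->]; rewrite ?eqxx ?orbT.
Qed.

Lemma extends_query_closed loc s : query_closed loc (extends s) (fun _ _ => True).
Proof.
split=> // [s' q p _ ext|s' q p phi b _ ext]; apply: extends_trans ext _.
  exact: enter_extends.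
exact: emit_extends.
Qed.

Lemma handle_extends n loc q p s : extends s (handle n loc q p s).
Proof.
apply: (handle_closed (extends_answer_closed s) (extends_query_closed loc s)) => //.
exact: extends_refl.
Qed.

Lemma in_qtable_handle n loc q p s : in_qtable (handle n.+1 loc q p s) q.
Proof.
have in_enter := in_qtable_enter (net_diam loc) q p s.
rewrite handleS /=; case: ifP => // _; case: child => [[q' par]|] //.
set s' := enter _ _ _ _ in in_enter *; apply: extends_in_qtable _ in_enter.
apply: (issue_closed (extends_answer_closed s')); last exact: extends_refl.
  by move=> _; apply: handle_extends.
by move=> phi b; apply: emit_extends.
Qed.

Lemma receive_query_extends loc s m : extends s (receive_query loc s m).
Proof.
apply: (receive_query_closed (extends_answer_closed s) (extends_query_closed loc s)) => //.
exact: extends_refl.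
Qed.

Lemma in_qtable_receive_queries loc s inbox q :
  Query q \in inbox -> in_qtable (foldl (receive_query loc) s inbox) q.
Proof.
elim: inbox s => //= m inbox IH s; rewrite inE => /predU1P[<-|]; last exact: IH.
have q_received : in_qtable (receive_query loc s (Query q)) q.
  by rewrite /=; case: ifP => // _; apply: in_qtable_handle.
apply: (foldl_invariant (P := fun s' => in_qtable s' q)) => // s' m' _.
exact/extends_in_qtable/receive_query_extends.
Qed.

Lemma node_round_extends loc req inbox s : extends (silence s) (node_round loc req inbox s).
Proof.
have [||||s' ext ->] // := node_round_closed (extends_answer_closed (silence s))
  (extends_query_closed loc (silence s)) (req := req) (inbox := inbox) (s := s).
- by move=> r _; case: first_query.
- by move=> s' phi b b' h _ _ ext; apply: extends_trans ext (emit_extends _ _).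
- exact: extends_refl.
Qed.

Lemma in_qtable_node_round loc req inbox s q :
  Query q \in inbox -> in_qtable (node_round loc req inbox s) q.
Proof.
rewrite /node_round -/(silence s); set s1 := (if req is Some r then _ else _).
move/(in_qtable_receive_queries loc s1); set s2 := foldl _ s1 _.
suff ext : extends s2 (elapse (foldl (receive_answer loc inbox) s2 inbox)).
  exact: extends_in_qtable ext.
apply: (elapse_closed (extends_answer_closed s2)); apply: foldl_invariant => [|s' m _ ext].
  exact: extends_refl.
apply: (receive_answer_closed (extends_answer_closed s2)) ext => s3 phi b b' h _ _ ext.
exact: extends_trans ext (emit_extends _ _).
Qed.

End EngineSteps.

(** * Widths of queries and subqueries *)

Section Queries.
Context (U : eqType).
Implicit Types (q par : query U) (p : option (query U)) (loc : local_data U).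
Implicit Types (phi : form (ident U)).

Definition query_width q : nat :=
  match q with
  | BoolQ phi => clock_width phi
  | PartQ xs _ phi => size xs + clock_width phi
  end.

Definition well_formed q : Prop :=
  match q with
  | BoolQ phi => simplified phi /\ sentence phi
  | PartQ xs _ phi => [/\ xs != [::], simplified phi & {subset free_vars phi <= xs}]
  end.

Lemma normal_unsettled phi : simplified phi -> ~~ settled (BoolQ phi) -> normal phi.
Proof. by rewrite /simplified /=; case: is_truth. Qed.

Lemma query_width_gt0 q : well_formed q -> ~~ settled q -> 0 < query_width q.
Proof.
case: q => [phi [simp_phi closed_phi] unsettled|[|x xs] vs phi []] //.
exact: clock_width_gt0 (normal_unsettled simp_phi unsettled) closed_phi.
Qed.

Lemma child_BoolQ loc phi q par : simplified phi -> sentence phi -> ~~ settled (BoolQ phi) ->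
  child loc (BoolQ phi) = Some (q, par) ->
  [/\ well_formed q, query_width q < clock_width phi & par = BoolQ phi].
Proof.
move=> simp_phi closed_phi unsettled /=; have normal_phi := normal_unsettled simp_phi unsettled.
case phi_inst: inst_leftmost => [[e psi]|].
  have phi_psi := inst_leftmost_instance phi_inst.
  case=> <- <-; split=> //=; last first.
    exact: leq_ltn_trans (leq_clock_width_simplify _ _) (ltn_clock_width_instance phi_psi).
  split; first exact: simplified_simplify_instance phi_psi.
  by move=> x /free_vars_simplify/(free_vars_instance phi_psi)/closed_phi.
case: eqP => // /eqP neq [<- <-]; have qfree := inst_leftmost_None phi_inst.
split=> //; last exact: ltn_clock_width_simplify.
split; first exact: simplified_simplify_normal.
by move=> x /free_vars_simplify/closed_phi.
Qed.

Lemma child_PartQ loc xs vs phi q par :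
  xs != [::] -> simplified phi -> {subset free_vars phi <= xs} ->
  child loc (PartQ xs vs phi) = Some (q, par) ->
  [/\ well_formed q, query_width q < size xs + clock_width phi
    & forall psi, par <> BoolQ psi].
Proof.
case: xs => //= x xs _ simp_phi sub_xs.
set phi' := simplify loc _.
have simp_phi' : simplified phi' by apply: simplified_simplify_subst.
have le_phi' : clock_width phi' <= clock_width phi.
  exact: leq_trans (leq_clock_width_simplify _ _) (leq_clock_width_subst _ _ _).
have : {subset free_vars phi' <= belast x xs}.
  move=> y /free_vars_simplify; rewrite free_vars_subst mem_filter => /andP[y_neq /sub_xs].
  by rewrite lastI mem_rcons inE (negPf y_neq).
have := size_belast x xs.
by case: belast => [|y ys] /= size_xs sub_ys [<- <-]; split=> //=;
   exact: (leq_add (eq_leq size_xs) le_phi').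
Qed.

Definition parent_ok (w : nat) q p : bool :=
  if p is Some (BoolQ psi) then query_width q < clock_width psi <= w else true.

(* The entries that a query table may contain when a query of width [w] was posed. *)
Definition entry_ok (w : nat) (e : query U * option (query U)) : Prop :=
  [/\ well_formed e.1, ~~ settled e.1, query_width e.1 <= w & parent_ok w e.1 e.2].

Lemma child_entry_ok w loc q p q' par : entry_ok w (q, p) ->
  child loc q = Some (q', par) -> ~~ settled q' ->
  entry_ok w (q', Some par) /\ query_width q' < query_width q.
Proof.
case: q => [phi|xs vs phi] [/= wf unsettled le_w _] q_child unsettled'.
  have [wf' lt_phi ->] := child_BoolQ wf.1 wf.2 unsettled q_child.
  by split=> //; split=> //=; [exact: leq_trans (ltnW lt_phi) le_w | rewrite lt_phi].
have [xs_neq simp_phi sub_xs] := wf.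
have [wf' lt_q par_part] := child_PartQ xs_neq simp_phi sub_xs q_child.
split=> //; split=> //; first exact: leq_trans (ltnW lt_q) le_w.
by case: (par) par_part => // psi /(_ psi).
Qed.

Lemma first_query_entry_ok loc (r : fo_query U) :
  let (q, p) := first_query loc r in
  ~~ settled q -> entry_ok (num_vars_consts r) (q, p).
Proof.
rewrite /first_query; set phi := simplify loc _.
have simp_phi : simplified phi by apply: simplified_simplify_map_form.
have le_phi : clock_width phi <= size (bound_vars (qform r)) + size (undup (consts (qform r))).
  apply: leq_trans (leq_clock_width_simplify _ _) _.
  rewrite clock_widthE bound_vars_map_form leq_add2l /posed_consts consts_map_form -map_comp.
  by rewrite (eq_map (_ : _ =1 fun c => [:: c])) // flatten_seq1.
have sub_qvars : {subset free_vars phi <= qvars r}.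
  by move=> x /free_vars_simplify; rewrite free_vars_map_form; apply: qvars_free.
rewrite /num_vars_consts -addnA.
by case: (qvars r) sub_qvars => [|x xs] sub_qvars unsettled; split; rewrite //= leq_add2l.
Qed.

End Queries.

(** * Invariant of a round *)

(* One round of a node, [n] rounds having been completed: [start] is the state of
   the node when the round begins, and [timely] holds of the queries that some node
   has recorded by their deadline. *)
Section RoundInvariant.
Context (U : eqType) (Delta w n : nat) (timely : query U -> Prop) (start : state U).
Implicit Types (q : query U) (p : option (query U)) (loc : local_data U) (s : state U).

(* A subquery is narrower than its parent, which takes at most [Delta] rounds to
   reach all nodes. *)
Definition issue_deadline (k : nat) : nat := Delta * (w - k).

Definition admissible q p : Prop :=
  entry_ok w (q, p) /\
  (n <= issue_deadline (query_width q) \/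
   [/\ p = None, timely q & n <= issue_deadline (query_width q) + Delta]).

Definition message_ok (m : message U) : bool :=
  match m with
  | Query _ => n < 2 * Delta * w
  | Answer _ _ h => (n.+1 + Delta <= 2 * Delta * w + h) && (h <= Delta)
  end.

Record round_inv s : Prop := RoundInv {
  inv_now : now s = n;
  inv_start : forall q, in_qtable start q -> in_qtable s q;
  inv_qtable : forall e, e \in qtable s ->
    entry_ok w e /\ (timely e.1 \/ n <= issue_deadline (query_width e.1));
  inv_clocks : forall c, c \in clocks s -> c.2 <= Delta * (w + clock_width c.1);
  inv_outbox : forall m, m \in outbox s -> message_ok m;
  inv_queries : forall q, Query q \in outbox s -> in_qtable s q
}.

Lemma emit_inv m s : message_ok m -> (forall q, m = Query q -> in_qtable s q) ->
  round_inv s -> round_inv (emit m s).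
Proof.
move=> m_ok m_s [I_now I_start I_qtable I_clocks I_outbox I_queries].
split=> // [m'|q]; rewrite mem_outbox_emit; first by case/predU1P=> [->|/I_outbox].
by case/predU1P=> [eq_m|/I_queries] //; apply: m_s.
Qed.

Lemma record_query_inv q p s :
  admissible q p -> round_inv s -> round_inv (record_query q p s).
Proof.
move=> [ok_qp time_q] [I_now I_start I_qtable I_clocks I_outbox I_queries].
have q_entry : entry_ok w (q, p) /\ (timely q \/ n <= issue_deadline (query_width q)).
  by split=> //; case: time_q => [?|[_ ? _]]; [right|left].
split=> [|q' /I_start q'_s|e||m m_out|q' q'_out]; rewrite ?in_qtable_record_query.
- by rewrite /record_query; case: ifP.
- by rewrite q'_s orbT.
- rewrite /record_query; case: ifP => _; first exact: I_qtable.
  by rewrite mem_rcons inE => /predU1P[->|/I_qtable].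
- by rewrite /record_query; case: ifP.
- by apply: I_outbox; move: m_out; rewrite /record_query; case: ifP.
- by rewrite I_queries ?orbT //; move: q'_out; rewrite /record_query; case: ifP.
Qed.

Lemma set_clock_inv phi s : n <= issue_deadline (clock_width phi) -> clock_width phi <= w ->
  round_inv s -> round_inv (set_clock Delta phi s).
Proof.
move=> le_n le_w; rewrite /set_clock; case: ifP => // _.
case=> I_now I_start I_qtable I_clocks I_outbox I_queries; split=> // c.
rewrite /= mem_rcons inE => /predU1P[->|/I_clocks //] /=.
have -> : w + clock_width phi = (w - clock_width phi) + 2 * clock_width phi by lia.
by rewrite I_now mulnDr mulnCA mulnA leq_add2r.
Qed.

Context (Delta_gt0 : 0 < Delta).

(* A node acts on the answer to a subquery only until the clock of that subquery
   elapses. *)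
Lemma leq_answer_parent_time phi psi s :
  (BoolQ phi, Some (BoolQ psi)) \in qtable s -> waiting s phi -> round_inv s ->
  n + Delta <= 2 * Delta * w.
Proof.
move=> phi_psi /hasP[c c_s /andP[/eqP eq_phi le_now]] inv_s.
have [[_ _ _ /= /andP[lt_psi le_w]] _] := inv_qtable inv_s phi_psi.
have le_n : n <= Delta * (w + clock_width phi).
  by rewrite -(inv_now inv_s) -eq_phi; apply: leq_trans le_now (inv_clocks inv_s c_s).
rewrite [2 * Delta]mulnC -mulnA (_ : 2 * w = (w + w.-1).+1); last lia.
by rewrite mulnS addnC leq_add2l (leq_trans le_n) // leq_mul2l; lia.
Qed.

Lemma emit_answer_inv phi b s : n + Delta <= 2 * Delta * w ->
  round_inv s -> round_inv (emit (Answer phi b 1) s).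
Proof. by move=> le_n; apply: emit_inv => //=; rewrite Delta_gt0 andbT; lia. Qed.

Lemma round_inv_answer_closed : answer_closed round_inv.
Proof.
split=> [s phi b []|s vs|s phi psi b phi_psi wait inv_s] //.
  by rewrite /record_result; case: ifP => // _ [].
exact: emit_answer_inv (leq_answer_parent_time phi_psi wait inv_s) inv_s.
Qed.

Lemma leq_admissible q p : admissible q p -> n <= issue_deadline (query_width q) + Delta.
Proof. by case=> _ [le_n|[]] //; apply: leq_trans le_n (leq_addr _ _). Qed.

Lemma leq_admissible_answer q p : admissible q p -> n + Delta <= 2 * Delta * w.
Proof.
move=> adm; have [[/= wf unsettled le_w _] _] := adm; have := query_width_gt0 wf unsettled.
have := leq_admissible adm; rewrite /issue_deadline addnC -mulnS => le_n gt0.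
have le_w1 : Delta * (w - query_width q).+1 <= Delta * w by rewrite leq_mul2l; lia.
have : Delta <= Delta * w by rewrite leq_pmulr; lia.
by rewrite -mulnA mul2n -addnn; lia.
Qed.

Lemma enter_inv q p s : admissible q p -> round_inv s -> round_inv (enter Delta q p s).
Proof.
move=> adm inv_s; have le_n := leq_admissible_answer adm.
have inv_await : round_inv (await Delta q p (record_query q p s)).
  have inv_s' := record_query_inv adm inv_s.
  case: q p adm inv_s' => [phi|xs vs phi] [par|] //= adm inv_s'.
  case: answer_of => [b|].
    apply: (resolve_closed round_inv_answer_closed) => // chi b'.
    exact: emit_answer_inv.
  by have [[_ _ le_w _] [le_phi|[]]] := adm => //; apply: set_clock_inv.
have := in_qtable_enter Delta q p s; rewrite /enter; case: ifP => // _ q_in.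
by apply: emit_inv => // [|q' [<-]] /=; [lia|exact: q_in].
Qed.

Lemma admissible_child loc q p q' par : admissible q p ->
  child loc q = Some (q', par) -> ~~ settled q' -> admissible q' (Some par).
Proof.
move=> adm q_child unsettled'; have [ok_qp _] := adm.
have [ok_q' lt_q] := child_entry_ok ok_qp q_child unsettled'; split=> //; left.
apply: leq_trans (leq_admissible adm) _; rewrite /issue_deadline addnC -mulnS leq_mul2l.
by case: ok_qp => _ _ /= le_w _; lia.
Qed.

Lemma round_inv_query_closed loc :
  net_diam loc = Delta -> query_closed loc round_inv admissible.
Proof.
move=> diam_loc; split=> [s q p|s q p phi b adm inv_s|].
- by rewrite diam_loc; apply: enter_inv.
- exact: emit_answer_inv (leq_admissible_answer adm) inv_s.
- exact: admissible_child.
Qed.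

Lemma node_round_inv loc req (inbox : seq (message U)) : net_diam loc = Delta ->
  (forall r, req = Some r -> n = 0 /\ num_vars_consts r = w) ->
  (forall q, Query q \in inbox -> entry_ok w (q, None) /\ timely q) ->
  (forall q, timely q -> ~~ in_qtable start q -> n <= issue_deadline (query_width q) + Delta) ->
  (forall phi b h, Answer phi b h \in inbox -> n + Delta <= 2 * Delta * w + h) ->
  round_inv (silence start) ->
  exists2 s, round_inv s & node_round loc req inbox start = tick s.
Proof.
move=> diam_loc req_first inbox_queries timely_flooded inbox_answers inv_s.
apply: (node_round_closed round_inv_answer_closed (round_inv_query_closed diam_loc)) => //.
- move=> r /req_first[n0 eq_w]; have := first_query_entry_ok loc r; rewrite eq_w.
  by case: first_query => q p ok_qp /ok_qp; split=> //; left; rewrite n0.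
- move=> s q /inbox_queries[ok_q timely_q] I_s fresh; split=> //; right; split=> //.
  by apply: timely_flooded => //; apply: contra fresh; apply: (inv_start I_s).
- move=> s phi b b' h /inbox_answers le_n; rewrite diam_loc => lt_h.
  by apply: emit_inv => //=; rewrite lt_h andbT; lia.
Qed.

End RoundInvariant.

(** * Executions *)

Lemma ex_least (P : nat -> Prop) :
  (exists n, P n) -> exists n, P n /\ forall m, P m -> n <= m.
Proof.
move/(dec_inh_nat_subset_has_unique_least_element P (fun n => classic (P n))).
by case=> n [[Pn n_min] _]; exists n; split=> // m /n_min/leP.
Qed.

Section Execution.
Context (d : Order.disp_t) (U : orderType d) (D : nat) (G : network U D) (Delta : nat).
Context (hDelta : is_diameter G Delta).

Lemma edge_endpoints u v : edge G u v -> u \in nodes G /\ v \in nodes G.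
Proof. by move=> uv; split; apply: edge_nodes; [|rewrite edge_sym]; exact: uv. Qed.

Lemma diameter_path u v : u \in nodes G -> v \in nodes G ->
  exists p, [/\ path (edge G) u p, last u p = v & size p <= Delta].
Proof.
move=> u_in v_in; have [p path_p last_p] := net_connected u_in v_in.
have [|k dist_k] := @ex_least (walk G u v); first by exists (size p), p.
have [p' [path_p' last_p' size_p']] := dist_k.1.
by exists p'; split=> //; rewrite size_p'; apply: hDelta.1 dist_k.
Qed.

Lemma edge_diameter_gt0 u v : edge G u v -> 0 < Delta.
Proof.
move=> uv; have [u_in v_in] := edge_endpoints uv.
have [p [_ last_p le_p]] := diameter_path u_in v_in; apply: leq_trans le_p.
by case: p last_p => //= eq_uv; rewrite eq_uv edge_irr in uv.
Qed.

Context (r : U) (psi : fo_query U).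

Local Notation exec := (execution G Delta r psi).
Local Notation w := (num_vars_consts psi).
Local Notation deadline q := (issue_deadline Delta w (query_width q)).
Local Notation inbox t v := (flatten [seq outbox (exec t u) | u <- neighbours G v]).

Lemma inbox_sender t v m :
  m \in inbox t v -> exists2 u, u \in nodes G & m \in outbox (exec t u).
Proof.
case/flatten_mapP => u; rewrite mem_filter => /andP[_ u_in] m_out.
by exists u.
Qed.

Lemma mem_inbox t u v m : edge G u v -> m \in outbox (exec t u) -> m \in inbox t v.
Proof.
move=> uv m_out; apply/flatten_mapP; exists u => //.
by rewrite mem_filter edge_sym uv (edge_endpoints uv).1.
Qed.

Lemma execS t v :
  exec t.+1 v = node_round (local_of G Delta v)
    (if (t == 0) && (v == r) then Some psi else None) (inbox t v) (exec t v).
Proof. by []. Qed.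

Lemma leq_in_qtable_exec t t' v q :
  t <= t' -> in_qtable (exec t v) q -> in_qtable (exec t' v) q.
Proof.
move=> /subnKC <-; elim: (t' - t) => [|k IH]; first by rewrite addn0.
move=> /IH q_in; rewrite addnS execS.
exact: extends_in_qtable (node_round_extends _ _ _ _) q_in.
Qed.

Lemma in_qtable_exec_edge t u v q :
  edge G u v -> in_qtable (exec t u) q -> in_qtable (exec t.+1 v) q.
Proof.
move=> uv; elim: t => // t IH.
have [_ _ new] : extends (silence (exec t u)) (exec t.+1 u).
  by rewrite execS; apply: node_round_extends.
case/new/orP => [/IH|sent]; first exact: leq_in_qtable_exec.
rewrite execS; apply: in_qtable_node_round.
exact: mem_inbox uv sent.
Qed.

Lemma in_qtable_exec_path t u p q : path (edge G) u p -> in_qtable (exec t u) q ->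
  in_qtable (exec (t + size p) (last u p)) q.
Proof.
elim: p t u => [|v p IH] t u /=; first by rewrite addn0.
by case/andP => uv path_p /(in_qtable_exec_edge uv); rewrite -addSnnS; apply: IH.
Qed.

Definition timely (q : query U) : Prop :=
  exists t u, [/\ u \in nodes G, in_qtable (exec t u) q & t <= (deadline q).+1].

Lemma timely_flooded t v q : v \in nodes G -> timely q -> ~~ in_qtable (exec t v) q ->
  t <= deadline q + Delta.
Proof.
move=> v_in [t0 [u [u_in q_u le_t0]]] /negP fresh.
have [p [path_p last_p le_p]] := diameter_path u_in v_in.
have := in_qtable_exec_path path_p q_u; rewrite last_p => q_v.
rewrite leqNgt; apply/negP => lt_t; apply/fresh/leq_in_qtable_exec/q_v; lia.
Qed.

Record exec_inv (t : nat) (v : U) : Prop := ExecInv {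
  exec_now : now (exec t v) = t;
  exec_qtable : forall e, e \in qtable (exec t v) -> entry_ok w e /\ timely e.1;
  exec_clocks : forall c, c \in clocks (exec t v) -> c.2 <= Delta * (w + clock_width c.1);
  exec_queries : forall q, Query q \in outbox (exec t v) ->
    t <= 2 * Delta * w /\ in_qtable (exec t v) q;
  exec_answers : forall phi b h, Answer phi b h \in outbox (exec t v) ->
    t + Delta <= 2 * Delta * w + h /\ h <= Delta
}.

Context (Delta_gt0 : 0 < Delta).

Lemma exec_round_inv t v : (forall u, u \in nodes G -> exec_inv t u) -> v \in nodes G ->
  exists2 s, round_inv Delta w t timely (exec t v) s & exec t.+1 v = tick s.
Proof.
move=> invs v_in; have [I_now I_qtable I_clocks _ _] := invs v v_in.
rewrite execS; apply: node_round_inv => //.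
- by case: eqP => //= -> r'; case: ifP => // _ [<-].
- move=> q /inbox_sender[u /invs I_u q_out].
  have [_ /mapP[[q' p] e_u ->]] := exec_queries I_u q_out.
  by have [[wf unsettled le_w _] timely_q] := exec_qtable I_u e_u.
- by move=> q; apply: timely_flooded.
- by move=> phi b h /inbox_sender[u /invs I_u /(exec_answers I_u)[]].
- by split=> //= e /I_qtable[ok_e timely_e]; split=> //; left.
Qed.

Lemma exec_invP t v : v \in nodes G -> exec_inv t v.
Proof.
elim: t v => [|t IH] v v_in; first by split.
have [s [I_now _ I_qtable I_clocks I_outbox I_queries] exec_v] := exec_round_inv IH v_in.
split; rewrite exec_v //=.
- by rewrite I_now.
- move=> e e_s; have [ok_e time_e] := I_qtable e e_s; split=> //.
  case: time_e => // le_t; exists t.+1, v; split=> //.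
  by rewrite exec_v; apply: map_f.
- by move=> q q_out; split; [exact: (I_outbox _ q_out)|exact: I_queries].
- by move=> phi b h /I_outbox /andP[]; lia.
Qed.

Lemma leq_message_sent t : message_sent G Delta r psi t -> t <= 2 * Delta * w.
Proof.
case=> u [v [u_in _ sent]]; have inv_u := exec_invP t u_in.
have [m m_out] : exists m, m \in outbox (exec t u).
  by case: (outbox _) sent => // m msgs _; exists m; apply: mem_head.
by case: m m_out => [q /(exec_queries inv_u)[]|phi b h /(exec_answers inv_u)] //; lia.
Qed.

End Execution.

Theorem theorem1 (d : Order.disp_t) (U : orderType d) (Uinf : infinite_set U)
    (D : nat) (G : network U D) (Delta : nat) (hDelta : is_diameter G Delta)
    (r : U) (hr : r \in nodes G) (psi : fo_query U) :
  exists T : nat, is_distributed_time G Delta r psi T /\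
    T <= 2 * Delta * num_vars_consts psi.
Proof.
have bound : terminated_after G Delta r psi (2 * Delta * num_vars_consts psi).
  move=> t lt_t sent; have [u [v [_ uv _]]] := sent.
  by have := leq_message_sent hDelta (edge_diameter_gt0 hDelta uv) sent; rewrite leqNgt lt_t.
have [T T_least] := ex_least (ex_intro _ _ bound).
by exists T; split=> //; apply: T_least.2.
Qed.
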